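(* Let $\varepsilon>0$ be a constant. Given a set $P$ of $n$ points in the plane with $\mathrm{diam}(P)$ bounded by a constant, a vertex cover $V\subseteq P$ of the unit disk graph of $P$ with $|V|\le(1+\varepsilon)|V_{\mathit{OPT}}|$, where $V_{\mathit{OPT}}$ is a minimum vertex cover of that graph, can be computed in $O(n)$ time on the real-RAM.
   Context: The unit disk graph of $P\subset\mathbb{R}^2$ has vertex set $P$, two points adjacent iff their Euclidean distance is at most $2$. A vertex cover is a set of vertices meeting every edge; the minimum vertex cover problem (VC) asks for one of minimum cardinality. $\mathrm{diam}(P)$ is the maximum distance between two points of $P$. *)

(* Defs.v *)
(* MathComp / MathComp-Analysis; points of the plane are pairs over a realType,
   finite point sets are finmap's {fset R * R}. *)
From HB Require Import structures.
From mathcomp Require Import all_boot all_order all_algebra finmap.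
From mathcomp Require Import boolp classical_sets reals topology normedtype.
From mathcomp Require Import landau.

Set Implicit Arguments.
Unset Strict Implicit.
Unset Printing Implicit Defensive.

Import Order.TTheory GRing.Theory Num.Theory.
Import numFieldNormedType.Exports.
Local Open Scope fset_scope.
Local Open Scope ring_scope.

Section UnitDiskGraph.
Variable R : realType.
Implicit Types (p q : R * R) (P : {fset R * R}).

(* The norm MathComp-Analysis puts on a product is the sup norm. *)
Definition eucl_dist p q : R :=
  Num.sqrt ((p.1 - q.1) ^+ 2 + (p.2 - q.2) ^+ 2).

(* Distances are nonnegative, so the default 0 of \big only matters for the
   empty set. *)
Definition diam P : R :=
  \big[Num.max/0]_(p <- P) \big[Num.max/0]_(q <- P) eucl_dist p q.

Definition udg_adj : rel (R * R) :=
  fun p q => (p != q) && (eucl_dist p q <= 2%:R).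

End UnitDiskGraph.

Section VertexCover.
Variables (T : choiceType) (e : rel T).

(* The graph has vertex set P and adjacency relation e restricted to P. *)
Definition vertex_cover (P V : {fset T}) : Prop :=
  V `<=` P /\
  forall p q : T, p \in P -> q \in P -> e p q -> (p \in V) || (q \in V).

Definition min_vertex_cover (P V : {fset T}) : Prop :=
  vertex_cover P V /\
  forall W : {fset T}, vertex_cover P W -> (#|` V| <= #|` W|)%N.

End VertexCover.

(* The real-RAM.  Two random access memories: index cells W[0], W[1], ... hold
   natural numbers and supply all addresses; real cells X[0], X[1], ... hold
   exact real numbers.  Every instruction costs 1.  There is no rounding and no
   conversion between reals and naturals.  Index cells are unbounded but cannot
   be multiplied, so unit cost does not hide superpolynomial computations on
   long integers.  Program literals are integers, not arbitrary reals. *)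
Inductive instr : Type :=
  | IConst of nat & nat        (* W[d] := c                              *)
  | IAdd of nat & nat & nat    (* W[d] := W[a] + W[b]                    *)
  | ISub of nat & nat & nat    (* W[d] := W[a] - W[b], truncated         *)
  | ILoad of nat & nat         (* W[d] := W[W[a]]                        *)
  | IStore of nat & nat        (* W[W[a]] := W[b]                        *)
  | XConst of nat & int        (* X[d] := z                              *)
  | XAdd of nat & nat & nat    (* X[d] := X[a] + X[b]                    *)
  | XSub of nat & nat & nat    (* X[d] := X[a] - X[b]                    *)
  | XMul of nat & nat & nat    (* X[d] := X[a] * X[b]                    *)
  | XDiv of nat & nat & nat    (* X[d] := X[a] / X[b], fails if X[b] = 0 *)
  | XLoad of nat & nat         (* X[d] := X[W[a]]                        *)
  | XStore of nat & nat        (* X[W[a]] := X[b]                        *)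
  | Jump of nat                (* goto l                                 *)
  | JumpIlt of nat & nat & nat (* if W[a] < W[b] then goto l             *)
  | JumpXlt of nat & nat & nat (* if X[a] < X[b] then goto l             *)
  | Halt.

Definition program := seq instr.

Section RealRAM.
Variable R : realType.

Record config := Config { pc : nat; wmem : nat -> nat; xmem : nat -> R }.

Definition upd (A : Type) (m : nat -> A) (d : nat) (v : A) : nat -> A :=
  fun i => if i == d then v else m i.

Definition exec_instr (i : instr) (c : config) : option config :=
  let: Config k w x := c in
  let setw d v := Some (Config k.+1 (upd w d v) x) in
  let setx d v := Some (Config k.+1 w (upd x d v)) in
  let goto l := Some (Config l w x) in
  match i with
  | IConst d n => setw d n
  | IAdd d a b => setw d (w a + w b)%N
  | ISub d a b => setw d (w a - w b)%N
  | ILoad d a => setw d (w (w a))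
  | IStore a b => setw (w a) (w b)
  | XConst d z => setx d z%:~R
  | XAdd d a b => setx d (x a + x b)
  | XSub d a b => setx d (x a - x b)
  | XMul d a b => setx d (x a * x b)
  | XDiv d a b => if x b == 0 then None else setx d (x a / x b)
  | XLoad d a => setx d (x (w a))
  | XStore a b => setx (w a) (x b)
  | Jump l => goto l
  | JumpIlt a b l => goto (if (w a < w b)%N then l else k.+1)
  | JumpXlt a b l => goto (if x a < x b then l else k.+1)
  | Halt => None
  end.

Definition step (M : program) (c : config) : option config :=
  obind (fun i => exec_instr i c) (onth M (pc c)).

Definition steps (M : program) (k : nat) (c : config) : option config :=
  iter k (obind (step M)) (Some c).

(* Leaving the program or dividing by zero blocks the machine without
   halting it. *)
Definition halted (M : program) (c : config) : Prop :=
  onth M (pc c) = Some Halt.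

(* W[0] holds the number of points, X[2k] and X[2k+1] the coordinates of the
   k-th point; all other cells are 0. *)
Definition input (s : seq (R * R)) : config :=
  Config 0 (upd (fun=> 0%N) 0 (size s))
    (fun i => let p := nth (0, 0) s i./2 in if odd i then p.2 else p.1).

(* The array of length W[1] starting at address W[0] of the index memory. *)
Definition output (c : config) : seq nat :=
  [seq wmem c (wmem c 0 + j)%N | j <- iota 0 (wmem c 1)].

(* On the array s of points, M halts after at most t steps and its output
   lists the positions in s of the points of V, each exactly once; using onth
   rules out positions beyond the end of s. *)
Definition computes_within (M : program) (s : seq (R * R)) (V : {fset R * R})
    (t : nat) : Prop :=
  exists (k : nat) (c : config),
    [/\ (k <= t)%N, steps M k (input s) = Some c, halted M c
      & perm_eq [seq onth s i | i <- output c] [seq Some v | v <- V]].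

End RealRAM.

(* Main.v *)
(* The points outside a vertex cover are pairwise more than 2 apart, so in a
   point set of diameter at most D there are at most K = K(D) of them, and any
   vertex cover has at least n - K points.  Hence once n exceeds
   N = (1 + eps) K / eps, the set of all points is a (1 + eps)-approximation,
   which takes one loop to write down.  For n < N the graph is determined by a
   bounded number of comparisons; the program, which may depend on eps and D,
   is a decision tree on them with an optimal cover hard-coded at each leaf. *)
Require Import Defs.
From HB Require Import structures.
From mathcomp Require Import all_boot all_order all_algebra finmap.
From mathcomp Require Import boolp classical_sets reals topology normedtype.
From mathcomp Require Import landau.
From mathcomp Require Import zify lra.

Set Implicit Arguments.
Unset Strict Implicit.
Unset Printing Implicit Defensive.

Import Order.TTheory GRing.Theory Num.Theory.
Import numFieldNormedType.Exports.
Local Open Scope classical_set_scope.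
Local Open Scope fset_scope.
Local Open Scope ring_scope.

(** * Code fragments inside a program and composition of runs *)

Definition code_at (M : program) (l : nat) (cs : program) : Prop :=
  forall i, (i < size cs)%N -> onth M (l + i) = onth cs i.

Lemma code_at_catl M l cs1 cs2 : code_at M l (cs1 ++ cs2) -> code_at M l cs1.
Proof. by move=> h i hi; rewrite h ?onth_cat ?hi // size_cat ltn_addr. Qed.

Lemma code_at_catr M l cs1 cs2 :
  code_at M l (cs1 ++ cs2) -> code_at M (l + size cs1) cs2.
Proof.
move=> h i hi; rewrite -addnA h ?size_cat ?ltn_add2l //.
by rewrite onth_cat ltnNge leq_addr /= addKn.
Qed.

Lemma code_at_head M l i cs : code_at M l (i :: cs) -> onth M l = Some i.
Proof. by move/(_ 0%N isT); rewrite addn0. Qed.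

Lemma code_at_tail M l i cs : code_at M l (i :: cs) -> code_at M l.+1 cs.
Proof. by rewrite -cat1s => /code_at_catr; rewrite addn1. Qed.

Local Arguments steps : simpl never.

Section Runs.
Variable R : realType.
Implicit Types (M : program) (c : config R) (s : seq (R * R)).

Lemma steps_cons M i k l w (x : nat -> R) c1 c2 : onth M l = Some i ->
  exec_instr i (Config l w x) = Some c1 -> steps M k c1 = Some c2 ->
  steps M k.+1 (Config l w x) = Some c2.
Proof.
by move=> hi he hk; rewrite /steps iterSr [obind _ _]/= /step hi [obind _ _]he.
Qed.

Lemma steps0 M c : steps M 0 c = Some c. Proof. by []. Qed.

Lemma steps_add M k1 k2 c c1 c2 : steps M k1 c = Some c1 ->
  steps M k2 c1 = Some c2 -> steps M (k1 + k2) c = Some c2.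
Proof. by rewrite /steps addnC iterD => ->. Qed.

(** * Decision trees on comparisons of the input *)

Fixpoint store (a : nat) (v : seq nat) : program :=
  if v is x :: v' then IConst a x :: store a.+1 v' else [::].

Lemma size_store a v : size (store a v) = size v.
Proof. by elim: v a => //= x v IH a; rewrite IH. Qed.

Lemma store_run M l a v c : code_at M l (store a v) -> pc c = l ->
  exists c', [/\ steps M (size v) c = Some c', pc c' = (l + size v)%N
    & forall i, wmem c' i =
        if (a <= i < a + size v)%N then nth 0%N v (i - a) else wmem c i].
Proof.
elim: v l a c => [|x v IH] l a c hM hl.
  exists c; split=> //; first by rewrite addn0.
  by move=> i; rewrite addn0; case: ifP => //; lia.
have [c' [h1 h2 h3]] := IH l.+1 a.+1 (Config l.+1 (upd (wmem c) a x) (xmem c))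
  (code_at_tail hM) erefl.
exists c'; split; last 1 first.
- move=> i; rewrite h3 /= /upd.
  have [->|ia] := eqVneq i a.
    by rewrite ltnn /= leqnn subnn addnS leq_addr.
  case: ifPn => hi; last by rewrite ifF //; lia.
  have -> : (i - a)%N = (i - a.+1).+1 by lia.
  by rewrite ifT //=; lia.
- case: c hl {h3} h1 => k w y /= -> h1.
  exact: steps_cons (code_at_head hM) erefl h1.
- by rewrite h2 addSnnS.
Qed.

(** Squared distances avoid the square root, which the machine cannot compute. The default point
    [(0, 0)] is the one [input] uses, so the test agrees with the machine even at positions beyond
    the end of [s]. *)
Definition far s (i j : nat) : bool :=
  let p := nth (0, 0) s i in let q := nth (0, 0) s j in
  4%:~R < (p.1 - q.1) * (p.1 - q.1) + (p.2 - q.2) * (p.2 - q.2).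

(* [inl m] is the test [n < m] on the number of points, [inr (i, j)] the test
   whether points i and j are at distance more than 2. *)
Definition query : Type := (nat + nat * nat)%type.

Definition answer s (q : query) : bool :=
  match q with inl m => (size s < m)%N | inr (i, j) => far s i j end.

(** Real cells [B] and [B.+1] are scratch, so the coordinates that a test reads have to lie below
    [B]. *)
Definition query_ok (B : nat) (q : query) : bool :=
  if q is inr (i, j) then (i.*2.+1 < B)%N && (j.*2.+1 < B)%N else true.

Definition query_code (B : nat) (q : query) : program :=
  match q with
  | inl m => [:: IConst 1 m]
  | inr (i, j) =>
    [:: XSub B i.*2 j.*2; XMul B B B; XSub B.+1 i.*2.+1 j.*2.+1;
        XMul B.+1 B.+1 B.+1; XAdd B B B.+1; XConst B.+1 4]
  end.

Definition query_jump (B : nat) (q : query) (l : nat) : instr :=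
  match q with inl _ => JumpIlt 0 1 l | inr _ => JumpXlt B.+1 B l end.

Definition holds_input B s c : Prop :=
  wmem c 0 = size s /\ forall i, (i < B)%N -> xmem c i = xmem (input s) i.

(** A test writes only to [W[1]] and to the scratch cells [B] and [B.+1], so the input survives for
    the tests after it. *)
Lemma query_run M B l l' q s c :
  code_at M l (query_code B q ++ [:: query_jump B q l']) -> query_ok B q ->
  pc c = l -> holds_input B s c ->
  exists c', [/\ steps M (size (query_code B q)).+1 c = Some c',
    holds_input B s c' &
    pc c' = if answer s q then l' else (l + (size (query_code B q)).+1)%N].
Proof.
case: c => k w x hM hq /= -> {k} [/= hw hx].
case: q hq hM => [m _|[i j] /andP[hi hj]] /= hM.
  exists (Config (if (size s < m)%N then l' else l.+2) (upd w 1 m) x).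
  split=> //; last by rewrite /= addn2.
  apply: steps_cons (code_at_head hM) erefl _.
  apply: steps_cons (code_at_head (code_at_tail hM)) _ (steps0 _ _).
  by rewrite /= /upd /= hw.
have {}hx a : (a < B)%N -> x a = xmem (input s) a by exact: hx.
eexists; split.
- apply: steps_cons (code_at_head hM) erefl _; move/code_at_tail in hM.
  do 5 (apply: steps_cons (code_at_head hM) erefl _; move/code_at_tail in hM).
  exact: steps_cons (code_at_head hM) erefl (steps0 _ _).
- split=> //= a ha; rewrite /upd.
  by rewrite !ifN_eq ?hx //; apply/eqP; lia.
- have e1 a : (a < B)%N -> (a == B) = false by lia.
  have e2 a : (a < B)%N -> (a == B.+1) = false by lia.
  have e3 : (B == B.+1) = false by lia.
  rewrite /= /upd /= !eqxx e3 ?(eq_sym B.+1 B) ?e3.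
  rewrite !e1 ?(ltnW hi) ?(ltnW hj) //=.
  rewrite !hx ?(ltnW hi) ?(ltnW hj) //= !odd_double !uphalf_double !doubleK /=.
  by rewrite /far addnS !addnS addn0.
Qed.

(* [tree B l qs leaf] is meant to be loaded at address l: jump targets are
   absolute. *)
Fixpoint tree (B l : nat) (qs : seq query) (leaf : seq bool -> seq nat) :
    program :=
  if qs is q :: qs' then
    let l1 := (l + (size (query_code B q)).+1)%N in
    let no := tree B l1 qs' (leaf \o cons false) in
    let l2 := (l1 + size no)%N in
    (query_code B q ++ [:: query_jump B q l2]) ++ no
      ++ tree B l2 qs' (leaf \o cons true)
  else let v := leaf [::] in
    store 2 v ++ [:: IConst 0 2; IConst 1 (size v); Halt].

(** All jumps of the tree go forward, so no instruction runs twice and the code size bounds the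
    time. At a leaf the array starts at address 2, because cells 0 and 1 must hold its address and
    length. *)
Lemma tree_run M B l qs leaf s c :
  code_at M l (tree B l qs leaf) -> all (query_ok B) qs ->
  pc c = l -> holds_input B s c ->
  exists k c', [/\ (k <= size (tree B l qs leaf))%N, steps M k c = Some c',
    halted M c' & output c' = leaf [seq answer s q | q <- qs]].
Proof.
elim: qs l leaf c => [|q qs IH] l leaf c /= hM.
  move=> _ hl _; set v := leaf [::] in hM *.
  have [[k w x] /= [h1 h2 h3]] := store_run (code_at_catl hM) hl.
  move/code_at_catr: hM; rewrite size_store -h2 => hM.
  exists (size v + 2)%N; eexists; split.
  - by rewrite size_cat size_store leq_add2l.
  - apply: steps_add h1 _.
    apply: steps_cons (code_at_head hM) erefl _; move/code_at_tail in hM.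
    exact: steps_cons (code_at_head hM) erefl (steps0 _ _).
  - by rewrite /halted /=; do 2 move/code_at_tail in hM; exact: code_at_head hM.
  rewrite /output /= /upd /=.
  apply: (@eq_from_nth _ 0%N); rewrite size_map size_iota // => i hi.
  rewrite (nth_map 0%N) ?size_iota // nth_iota //= h3.
  by rewrite leq_addr ltn_add2l hi addKn.
case/andP=> hq hqs hl hc.
have [c1 [h1 h2 h3]] := query_run (code_at_catl hM) hq hl hc.
move/code_at_catr: hM; rewrite !size_cat /= addn1 => hM.
case: (answer s q) h3 => h3; last first.
  have [k [c2 [hk hs hh ho]]] := IH _ _ _ (code_at_catl hM) hqs h3 h2.
  exists ((size (query_code B q)).+1 + k)%N, c2; split=> //.
    by rewrite leq_add2l (leq_trans hk) ?leq_addr.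
  exact: steps_add h1 hs.
have [k [c2 [hk hs hh ho]]] := IH _ _ _ (code_at_catr hM) hqs h3 h2.
exists ((size (query_code B q)).+1 + k)%N, c2; split=> //.
  by rewrite leq_add2l (leq_trans hk) ?leq_addl.
exact: steps_add h1 hs.
Qed.

(** * The loop that outputs all positions *)

(** [W[1]] is the counter, [W[2]] the number of points, [W[3]] the constant 1 and [W[4]] the write
    pointer; the array starts at 5, just after them. On exit the counter is already the output
    length. *)
Definition id_code (l : nat) : program :=
  [:: IConst 1 0; IAdd 2 0 1; IConst 3 1; IConst 4 5;
      IStore 4 1; IAdd 4 4 3; IAdd 1 1 3; JumpIlt 1 2 (l + 4);
      IConst 0 5; Halt].

(** Induction on the iterations still to run, [m.+1] of them since the test follows the body. Each
    takes 4 steps and writes at [5 + i], clear of the registers and of earlier entries. *)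
Lemma id_loop_run M l n m i c : code_at M l (id_code l) ->
  pc c = (l + 4)%N -> n = (i + m.+1)%N ->
  [/\ wmem c 1 = i, wmem c 2 = n, wmem c 3 = 1%N & wmem c 4 = (5 + i)%N] ->
  (forall j, (j < i)%N -> wmem c (5 + j) = j) ->
  exists c', [/\ steps M (4 * m.+1) c = Some c', pc c' = (l + 8)%N,
    wmem c' 1 = n & forall j, (j < n)%N -> wmem c' (5 + j) = j].
Proof.
move=> hM; elim: m i c => [|m IH] i [k w x] /= -> hn [h1 h2 h3 h4] hj;
  have f4 := hM 4%N isT; have f5 := hM 5%N isT; have f6 := hM 6%N isT;
  have f7 := hM 7%N isT; rewrite /= in f4 f5 f6 f7.
  exists (Config (l + 8)%N
    (upd (upd (upd w (5 + i) i) 4 (6 + i)) 1 i.+1)%N x); split=> //=.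
  - apply: steps_cons f4 erefl _; rewrite /= -addnS h4 h1.
    apply: steps_cons f5 erefl _; rewrite /= -addnS.
    apply: steps_cons f6 erefl _; rewrite /= -addnS.
    apply: steps_cons f7 _ (steps0 _ _); rewrite /= /upd /= h1 h2 h3 h4.
    by rewrite hn !addn1 ltnn -addnS addnC.
  - by rewrite hn addn1.
  - move=> j hji; rewrite /upd /=; case: eqVneq => [|e]; first lia.
    by apply: hj; lia.
have [||| c' [g1 g2 g3 g4]] := IH i.+1 (Config (l + 4)%N
    (upd (upd (upd w (5 + i) i) 4 (6 + i)) 1 i.+1)%N x) erefl.
- by rewrite addSnnS.
- by split; rewrite /upd //= addnS.
- move=> j hji; rewrite /upd /=; case: eqVneq => [|e]; first lia.
  by apply: hj; lia.
exists c'; split=> //; rewrite (_ : (4 * m.+2)%N = (4 * m.+1).+4); last lia.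
apply: steps_cons f4 erefl _; rewrite /= -addnS h4 h1.
apply: steps_cons f5 erefl _; rewrite /= -addnS.
apply: steps_cons f6 erefl _; rewrite /= -addnS.
apply: steps_cons f7 _ g1; rewrite /= /upd /= h1 h2 h3 h4.
by rewrite hn !addn1 ifT ?(addnC _ 1%N) //; lia.
Qed.

(** Four initialisations, the loop, and one final assignment to [W[0]]. The input must be nonempty
    because the loop writes before it tests. *)
Lemma id_run M l s c : code_at M l (id_code l) -> pc c = l ->
  wmem c 0 = size s -> (0 < size s)%N ->
  exists c', [/\ steps M (4 + (4 * size s + 1)) c = Some c', halted M c'
    & output c' = iota 0 (size s)].
Proof.
case: c => k w x hM /= -> h0 hs.
pose w' := (upd (upd (upd (upd w 1 0) 2 (size s)) 3 1) 4 5)%N.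
have [||| c' [g1 g2 g3 g4]] := @id_loop_run M l (size s) (size s).-1 0
   (Config (l + 4)%N w' x) hM erefl.
- by rewrite add0n prednK.
- by split.
- by [].
rewrite prednK // in g1; case: c' g2 g1 g3 g4 => k' w1 x' /= -> g1 g3 g4.
exists (Config (l + 9)%N (upd w1 0 5)%N x'); split.
- have hM' := hM.
  apply: (@steps_add _ 4 _ _ (Config (l + 4)%N w' x)).
    apply: steps_cons (code_at_head hM) erefl _; move/code_at_tail in hM.
    apply: steps_cons (code_at_head hM) erefl _; move/code_at_tail in hM.
    apply: steps_cons (code_at_head hM) erefl _; move/code_at_tail in hM.
    apply: steps_cons (code_at_head hM) _ (steps0 _ _).
    by rewrite /= addn4 /w' -h0 /upd /= addn0.
  apply: steps_add g1 _.
  by apply: steps_cons (hM' 8%N isT) _ (steps0 _ _); rewrite /= -addnS.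
- exact: hM 9%N isT.
rewrite /output /= {2 3}/upd /= g3.
rewrite -[RHS]map_id; apply/eq_in_map => j; rewrite mem_iota /= => hj.
exact: g4.
Qed.

End Runs.

(** * Vertex covers as lists of positions *)

Section Covers.
Variable R : realType.
Implicit Types (p q : R * R) (s : seq (R * R)) (P V : {fset R * R}).

Lemma eucl_dist_le2 p q : (eucl_dist p q <= 2%:R) =
  ((p.1 - q.1) * (p.1 - q.1) + (p.2 - q.2) * (p.2 - q.2) <= 4%:~R).
Proof.
rewrite -!expr2 /eucl_dist -[2%:R]ger0_norm // -sqrtr_sqr ler_sqrt ?sqr_ge0 //.
by rewrite -natrX.
Qed.

Lemma udg_adj_nth s i j : uniq s -> (i < size s)%N -> (j < size s)%N ->
  udg_adj (nth (0, 0) s i) (nth (0, 0) s j) = (i != j) && ~~ far s i j.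
Proof.
by move=> us hi hj; rewrite /udg_adj nth_uniq // eucl_dist_le2 /far -leNgt.
Qed.

(** Phrased by positions and [far] alone, so that it depends on [s] only through its length and the
    distance tests. *)
Definition position_cover s (w : seq nat) : Prop :=
  [/\ uniq w, all (fun i => i < size s)%N w &
    forall i j, (i < size s)%N -> (j < size s)%N -> i != j -> ~~ far s i j ->
      (i \in w) || (j \in w)].

Definition points s (w : seq nat) : {fset R * R} :=
  seq_fset tt [seq nth (0, 0) s i | i <- w].

Lemma mem_perm_fset s P p : perm_eq s P -> (p \in P) = (p \in s).
Proof. by move=> sP; exact: (esym (perm_mem sP p)). Qed.

(** Used to compare an arbitrary optimal cover of the graph with the list chosen by the program. *)
Lemma position_cover_index s P V : perm_eq s P ->
  vertex_cover (@udg_adj R) P V -> position_cover s [seq index p s | p <- V].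
Proof.
move=> sP [/fsubsetP VP cV].
have us : uniq s by rewrite (perm_uniq sP) fset_uniq.
have memV p : p \in V -> p \in s by move/VP; rewrite (mem_perm_fset _ sP).
split.
- rewrite map_inj_in_uniq ?fset_uniq // => p q /memV ps /memV qs e.
  by rewrite -(nth_index p ps) e nth_index.
- by apply/allP => _ /mapP[p /memV ps ->]; rewrite index_mem.
move=> i j hi hj ij fij.
have := cV (nth (0, 0) s i) (nth (0, 0) s j).
rewrite !(mem_perm_fset _ sP) !mem_nth // udg_adj_nth // ij fij.
case/(_ isT isT isT)/orP => h; apply/orP; [left|right]; apply/mapP;
  by eexists; [exact: h|rewrite index_uniq].
Qed.

Lemma uniq_map_nth s w : uniq s -> uniq w -> all (fun i => i < size s)%N w ->
  uniq [seq nth (0, 0) s i | i <- w].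
Proof.
move=> us uw /allP hw; rewrite map_inj_in_uniq // => i j /hw hi /hw hj /eqP.
by rewrite nth_uniq // => /eqP.
Qed.

Lemma card_points s w : uniq s -> position_cover s w ->
  #|` points s w| = size w.
Proof.
by move=> us [uw hw _]; rewrite size_seq_fset undup_id ?size_map ?uniq_map_nth.
Qed.

Lemma vertex_cover_points s P w : perm_eq s P -> position_cover s w ->
  vertex_cover (@udg_adj R) P (points s w).
Proof.
move=> sP [uw /allP hw cw].
have us : uniq s by rewrite (perm_uniq sP) fset_uniq.
split.
  apply/fsubsetP => p; rewrite seq_fsetE => /mapP[i /hw hi ->].
  by rewrite (mem_perm_fset _ sP) mem_nth.
move=> p q; rewrite !(mem_perm_fset _ sP) => ps qs.
rewrite -(nth_index (0, 0) ps) -(nth_index (0, 0) qs).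
rewrite udg_adj_nth ?index_mem // => /andP[ij fij].
have hp := etrans (index_mem p s) ps; have hq := etrans (index_mem q s) qs.
have /orP[h|h] := cw _ _ hp hq ij fij;
  by apply/orP; [left + right]; rewrite seq_fsetE map_f.
Qed.

Lemma computes_within_points M s w k t (c : config R) : uniq s ->
  position_cover s w -> (k <= t)%N -> steps M k (input s) = Some c ->
  halted M c -> output c = w -> computes_within M s (points s w) t.
Proof.
move=> us [uw /allP hw _] kt hk hh ho; exists k, c; split=> //; rewrite ho.
have -> : [seq onth s i | i <- w] =
    [seq Some p | p <- [seq nth (0, 0) s i | i <- w]].
  rewrite -map_comp; apply/eq_in_map => i /hw hi /=.
  by rewrite onthE (nth_map (0, 0)).
apply: perm_map; rewrite perm_sym.
rewrite -[X in perm_eq _ X]undup_id; first exact: seq_fset_perm.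
by apply: uniq_map_nth => //; apply/allP.
Qed.

Lemma position_cover_iota s : position_cover s (iota 0 (size s)).
Proof.
split; first exact: iota_uniq.
  by apply/allP => i; rewrite mem_iota.
by move=> i j hi _ _ _; rewrite mem_iota hi.
Qed.

(** * Optimal covers determined by finitely many answers *)

Definition optimal s (w : seq nat) : Prop :=
  position_cover s w /\
  forall w', position_cover s w' -> (size w <= size w')%N.

Lemma optimal_exists s : exists w, optimal s w.
Proof.
pose Q m := `[< exists w, position_cover s w /\ size w = m >].
have exQ : exists m, Q m.
  by exists (size (iota 0 (size s))); apply/asboolP; eexists; split;
    first exact: position_cover_iota.
case: (ex_minnP exQ) => m /asboolP[w [cw <-]] min_m.
by exists w; split=> // w' cw'; apply: min_m; apply/asboolP; exists w'.
Qed.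

(** For inputs shorter than [N], the first group determines the length and the second all
    adjacencies. *)
Definition queries (N : nat) : seq query :=
  map inl (iota 0 N) ++ map inr (allpairs pair (iota 0 N) (iota 0 N)).

Lemma queries_ok N : all (query_ok N.*2) (queries N).
Proof.
apply/allP => k; rewrite mem_cat => /orP[/mapP[m _ ->] //|].
case/mapP=> _ /allpairsP[[i j] /= [hi hj ->]] ->.
by move: hi hj; rewrite !mem_iota /= => hi hj; apply/andP; lia.
Qed.

(** The size test whose threshold is the length of one input fails there, hence also at the other
    input; so neither length is below the other. *)
Lemma eq_size_of_answers N s s' : (size s < N)%N -> (size s' < N)%N ->
  [seq answer s k | k <- queries N] = [seq answer s' k | k <- queries N] ->
  size s = size s'.
Proof.
move=> hs hs' /eq_in_map e.
have he m : (m < N)%N -> (size s < m)%N = (size s' < m)%N.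
  by move=> hm; apply: (e (inl m)); rewrite mem_cat map_f // mem_iota.
by apply/eqP; rewrite eqn_leq leqNgt -he // ltnn leqNgt he // ltnn.
Qed.

Lemma optimal_of_answers N s s' w : (size s < N)%N -> (size s' < N)%N ->
  [seq answer s k | k <- queries N] = [seq answer s' k | k <- queries N] ->
  optimal s w -> optimal s' w.
Proof.
move=> hs hs' e; have es := eq_size_of_answers hs hs' e.
have ef i j : (i < size s)%N -> (j < size s)%N -> far s i j = far s' i j.
  move=> hi hj; move/eq_in_map: e => e; apply: (e (inr (i, j))).
  rewrite mem_cat [X in _ || X]map_f ?orbT //.
  by apply: allpairs_f; rewrite mem_iota; lia.
have ce v : position_cover s v <-> position_cover s' v.
  rewrite /position_cover es; split=> -[uv hv cv]; split=> // i j hi hj ij;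
    [rewrite -ef ?es //|rewrite ef ?es //]; exact: cv.
by move=> [/ce cw mw]; split=> // w' /ce; exact: mw.
Qed.

(** An optimal list for one input serves every input with the same answers, so choosing one list per
    answer vector gives a single table, fixed before any input is seen. *)
Lemma optimal_leaf_exists N : exists leaf : seq bool -> seq nat,
  forall s, (size s < N)%N ->
    optimal s (leaf [seq answer s k | k <- queries N]).
Proof.
have [bits|leaf hleaf] := @choice (seq bool) (seq nat) (fun bits w =>
    forall s, (size s < N)%N -> [seq answer s k | k <- queries N] = bits ->
    optimal s w).
  have [[s0 [hs0 <-]]|no] := pselect (exists s, (size s < N)%N /\
      [seq answer s k | k <- queries N] = bits).
    have [w hw] := optimal_exists s0.
    by exists w => s hs e; exact: optimal_of_answers hs0 hs (esym e) hw.
  (* Answer vectors that no short input realises get an arbitrary list. *)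
  by exists [::] => s hs e; case: no; exists s.
by exists leaf => s hs; exact: hleaf.
Qed.

(** * Packing in a set of bounded diameter *)

Lemma eucl_dist_le_diam P p q : p \in P -> q \in P -> eucl_dist p q <= diam P.
Proof.
move=> pP qP; apply: le_trans (le_bigmax_seq _ _ _ _ pP isT).
exact: le_bigmax_seq.
Qed.

Lemma le_eucl_dist p q :
  (`|p.1 - q.1| <= eucl_dist p q) * (`|p.2 - q.2| <= eucl_dist p q).
Proof.
split; rewrite -sqrtr_sqr ler_sqrt ?addr_ge0 ?sqr_ge0 //.
  by rewrite lerDl sqr_ge0.
by rewrite lerDr sqr_ge0.
Qed.

(** The number of unit cells used to cover a square of side [2D] centred at one of the points. *)
Definition packing_bound (D : R) : nat := ((Num.truncn (D + D)).+1 ^ 2)%N.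

(* Two points in the same cell of the unit grid are at distance less than 2. *)
Lemma card_separated P (I : {fset R * R}) (D : R) : diam P <= D ->
  {subset I <= P} -> {in I &, forall p q, ~~ udg_adj p q} ->
  (#|` I| <= packing_bound D)%N.
Proof.
move=> hD IP sep; have [->|[p0 p0I]] := fset_0Vmem I; first by rewrite cardfs0.
(* The shift by [D] makes the argument nonnegative, so that truncation to a natural number is the
   floor. *)
pose f (x y : R) := Num.truncn (x - y + D).
have hf p : p \in I -> (`|p.1 - p0.1| <= D) * (`|p.2 - p0.2| <= D).
  move=> pI; have h := le_trans (eucl_dist_le_diam (IP _ pI) (IP _ p0I)) hD.
  by split; [apply: le_trans (le_eucl_dist _ _).1 h
            |apply: le_trans (le_eucl_dist _ _).2 h].
have fitv (x y : R) : `|x - y| <= D ->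
    ((f x y)%:R <= x - y + D < (f x y).+1%:R).
  by rewrite ler_norml => /andP[h1 h2]; apply: Num.Theory.truncn_itv; lra.
have flt (x y : R) : `|x - y| <= D -> (f x y < (Num.truncn (D + D)).+1)%N.
  rewrite ler_norml ltnS => /andP[h1 h2].
  by apply: Num.Theory.le_truncn; lra.
pose m := Num.truncn (D + D).
pose g (p : R * R) : 'I_m.+1 * 'I_m.+1 :=
  (inord (f p.1 p0.1), inord (f p.2 p0.2)).
have close (x y z : R) : `|x - z| <= D -> `|y - z| <= D -> f x z = f y z ->
    (x - y) * (x - y) <= 1.
  move=> /fitv /andP[a1 a2] /fitv /andP[b1 b2] e.
  rewrite e in a1 a2; rewrite -natr1 in a2 b2.
  by rewrite -expr2 -real_normK ?num_real // expr_le1 // ler_norml; lra.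
have ginj : {in I &, injective g}.
  move=> p q pI qI [/(congr1 val) e1 /(congr1 val) e2].
  have [p1 p2] := hf _ pI; have [q1 q2] := hf _ qI.
  rewrite /= !inordK ?flt // in e1 e2.
  apply/eqP; apply: contraNT (sep _ _ pI qI) => pq.
  rewrite /udg_adj pq eucl_dist_le2.
  have := close _ _ _ p1 q1 e1; have := close _ _ _ p2 q2 e2; lra.
have -> : packing_bound D = #|{: 'I_m.+1 * 'I_m.+1}|.
  by rewrite card_prod card_ord mulnn.
rewrite -(size_map g) cardE; apply: uniq_leq_size => [|u _].
  by rewrite map_inj_in_uniq ?fset_uniq.
by rewrite mem_enum.
Qed.

(** The complement of a cover spans no edge, so the packing bound applies to it. *)
Lemma card_vertex_cover_ge P V (D : R) : diam P <= D ->
  vertex_cover (@udg_adj R) P V -> (#|` P| <= #|` V| + packing_bound D)%N.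
Proof.
move=> hD [VP cV]; rewrite -leq_subLR -cardfsDS //.
apply: card_separated hD _ _ => [p|p q].
  by rewrite inE => /andP[].
rewrite !inE => /andP[pV pP] /andP[qV qP].
by apply/negP => /(cV _ _ pP qP); rewrite (negPf pV) (negPf qV).
Qed.

End Covers.

(** * Running time and the approximation ratio *)

Lemma affine_bigO (R : realType) (a b : nat) :
  (fun n => (a + b * n)%:R : R^o) =O_\oo (fun n => n%:R : R^o).
Proof.
(* The successor keeps the constant positive when [a = b = 0]; the bound holds from [n = 1] on. *)
apply/eqO_exP; exists (a + b).+1%:R; first by rewrite ltr0n.
near=> n.
rewrite !ger0_norm ?ler0n // -natrM ler_nat.
have : (0 < n)%N by near: n; exact: nbhs_infty_ge.
nia.
Unshelve. all: by end_near.
Qed.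

Theorem theorem5 (R : realType) (eps D : R) (heps : 0 < eps) :
  exists (M : program) (t : nat -> nat),
    ((fun n => (t n)%:R : R^o) =O_\oo (fun n => n%:R : R^o)) /\
    forall (P : {fset R * R}) (s : seq (R * R)),
      diam P <= D -> perm_eq s P ->
      exists V : {fset R * R},
        [/\ computes_within M s V (t #|` P|),
            vertex_cover (@udg_adj R) P V
          & forall Vopt : {fset R * R},
              min_vertex_cover (@udg_adj R) P Vopt ->
              #|` V|%:R <= (1 + eps) * #|` Vopt|%:R].
Proof.
pose K := packing_bound D.
(* The successor puts [N] strictly above the threshold and makes it positive, so the loop never
   meets an empty input. *)
pose N := (Num.truncn ((1 + eps) * K%:R / eps)).+1.
have [leaf hleaf] := optimal_leaf_exists R N.
(* Coordinates of the first [N] points fill the cells below [N.*2]. Address 12 follows the two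
   dispatch instructions and the ten of [id_code]. *)
pose T := tree N.*2 12 (queries N) leaf.
pose M := [:: IConst 1 N; JumpIlt 0 1 12] ++ id_code 2 ++ T.
(* Dispatch takes 2 steps; then the tree takes at most [size T] and the loop [4 + 4 * n + 1]. The
   sum covers both branches. *)
exists M, (fun n => (size T + 7 + 4 * n)%N); split; first exact: affine_bigO.
move=> P s hD sP; have us : uniq s by rewrite (perm_uniq sP) fset_uniq.
have sizeP : #|` P| = size s by rewrite (perm_size sP).
pose c := Config (if (size s < N)%N then 12 else 2)
  (upd (upd (fun=> 0) 0 (size s)) 1 N)%N (xmem (input s)).
have hc : steps M 2 (input s) = Some c by [].
have [hs|hs] := ltnP (size s) N.
  have hM : code_at M 12 T by move=> i hi.
  have pc_c : pc c = 12%N by rewrite /c hs.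
  have [|k [c' [hk hk' hh ho]]] := tree_run hM (queries_ok N) pc_c (s := s).
    by [].
  have [cw mw] := hleaf s hs; rewrite -ho in cw mw.
  exists (points s (output c')); split.
  - apply: computes_within_points us cw _ (steps_add hc hk') hh erefl.
    by rewrite -/T in hk; lia.
  - exact: vertex_cover_points.
  move=> Vopt [cV _]; rewrite card_points //.
  have := mw _ (position_cover_index sP cV); rewrite size_map => hle.
  rewrite (@le_trans _ _ #|` Vopt|%:R) ?ler_nat // ler_peMl ?ler0n //.
  by rewrite lerDl ltW.
have hM : code_at M 2 (id_code 2).
  by apply: (@code_at_catl _ _ _ T); exact: (@code_at_catr M 0 [:: _; _]).
have pc_c : pc c = 2%N by rewrite /c ltnNge hs.
have [||c' [hk hh ho]] := id_run hM pc_c (s := s).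
- by [].
- exact: leq_trans hs.
exists (points s (iota 0 (size s))); split.
- apply: computes_within_points (steps_add hc hk) hh ho => //.
    exact: position_cover_iota.
  by rewrite sizeP; lia.
- exact: vertex_cover_points sP (position_cover_iota s).
move=> Vopt [cV _]; rewrite card_points ?size_iota //;
  last exact: position_cover_iota.
have hle : (size s)%:R <= #|` Vopt|%:R + K%:R :> R.
  by rewrite -natrD ler_nat -sizeP (card_vertex_cover_ge hD cV).
have hN : (1 + eps) * K%:R / eps < (size s)%:R.
  by rewrite (lt_le_trans (Num.Theory.truncnS_gt _)) // ler_nat.
rewrite ltr_pdivrMr // in hN.
(* With [n = size s], adding [hle] to its multiple by [eps] gives [(1 + eps) * n <= (1 + eps) *
   (#|Vopt| + K)]; by [hN] the term [(1 + eps) * K] is less than [eps * n], which cancels. *)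
have := ler_wpM2l (ltW heps) hle; nra.
Qed.
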